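(* Let $\mathbb{X}$ be a real Banach space with $\dim \mathbb{X} \geq 3$. Then $\mathbb{X}$ is a Hilbert space if and only if there exists $T \in \mathbb{L}(\mathbb{X}, \mathbb{X}^* )$ such that $\perp_T = \perp_B$.
   Context: $\mathbb{X}^*$ is the dual space of $\mathbb{X}$ and $\mathbb{L}(\mathbb{X},\mathbb{X}^* )$ is the set of all bounded linear operators from $\mathbb{X}$ to $\mathbb{X}^*$. For $x,y\in\mathbb{X}$, $x \perp_T y$ means $Tx(y)=0$. Birkhoff-James orthogonality: $x\perp_B y$ means $\|x+\lambda y\|\ge\|x\|$ for all scalars $\lambda\in\mathbb{R}$. $\perp_T=\perp_B$ means that for all $x,y\in\mathbb{X}$, $x\perp_T y\iff x\perp_B y$. ''$\mathbb{X}$ is a Hilbert space'' means that the norm of $\mathbb{X}$ is induced by an inner product. The dimension may be infinite. *)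

(* Defs.v *)
From HB Require Import structures.
From mathcomp Require Import all_boot all_order all_algebra.
From mathcomp Require Import all_classical all_reals all_analysis.
Import Order.TTheory GRing.Theory Num.Theory.
Import numFieldNormedType.Exports.

Set Implicit Arguments.
Unset Strict Implicit.
Unset Printing Implicit Defensive.

Local Open Scope classical_set_scope.
Local Open Scope ring_scope.

Definition bounded_operator (R : realType) (V W : normedModType R)
    (f : V -> W) : Prop :=
  exists M : R, forall x, `|f x| <= M * `|x|.

Lemma bounded_operatorP (R : realType) (V W : normedModType R)
    (f : {linear V -> W}) :
  bounded_operator f <-> bounded_near f (nbhs (0 : V)).
Proof.
rewrite linear_boundedP; split=> [[M fM]|/pinfty_ex_gt0[M _ fM]]; last first.
  by exists M.
exists M; split; first exact: num_real.
by move=> r /ltW Mr x; rewrite (le_trans (fM x))// ler_wpM2r.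
Qed.

(* The dual space: bounded linear functionals, normed by the operator norm. *)
Section Dual.
Context (R : realType) (V : normedModType R).

Definition dual_pred : {pred V -> R^o} :=
  fun f => `[< linear f /\ bounded_operator f >].

Lemma dual_submod_closed : submod_closed dual_pred.
Proof.
split.
  apply/asboolP; split=> [a x y|]; first by rewrite /= scaler0 addr0.
  by exists 0 => x; rewrite normr0 mul0r.
move=> a f g /asboolP[lf [M fM]] /asboolP[lg [N gN]]; apply/asboolP; split.
  move=> b x y; rewrite !fctE lf lg !scalerDr !scalerA (mulrC a b).
  by rewrite -!addrA; congr (_ + _); rewrite addrCA.
exists (`|a| * M + N) => x; rewrite mulrDl (le_trans (ler_normD _ _))// lerD//.
by rewrite fctE normrZ -mulrA ler_wpM2l.
Qed.

HB.instance Definition _ := GRing.isSubmodClosed.Build R (V -> R^o) dual_pred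
  dual_submod_closed.

Record dual := Dual { dual_fun :> V -> R^o; _ : dual_fun \in dual_pred }.

HB.instance Definition _ := [isSub for dual_fun].
HB.instance Definition _ := [Choice of dual by <:].
HB.instance Definition _ := [SubChoice_isSubLmodule of dual by <:].

Lemma dual_linear (f : dual) : linear f.
Proof. by case: f => f /= /asboolP[]. Qed.

HB.instance Definition _ (f : dual) :=
  GRing.isLinear.Build R V R^o *:%R (dual_fun f) (dual_linear f).

Lemma dual_bounded (f : dual) : bounded_operator f.
Proof. by case: f => f /= /asboolP[]. Qed.

Lemma dualP (f g : dual) : f =1 g -> f = g.
Proof. by move=> fg; apply/val_inj/funext. Qed.

Definition dual_norm (f : dual) : R := sup [set `|f x| | x in [set x | `|x| <= 1]].

Let dual_norm_has_sup (f : dual) :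
  has_sup [set `|f x| | x in [set x | `|x| <= 1]].
Proof.
split; first by exists `|f 0|, 0 => //=; rewrite normr0.
have [M fM] := dual_bounded f; exists `|M| => _ /= [x x1 <-].
rewrite (le_trans (fM x))// (le_trans (ler_wpM2r _ (ler_norm M)))//.
by rewrite ler_piMr.
Qed.

Let dual_norm_le1 (f : dual) x : `|x| <= 1 -> `|f x| <= dual_norm f.
Proof.
by move=> x1; apply: ub_le_sup; [case: (dual_norm_has_sup f)|exists x].
Qed.

Lemma dual_norm_ge0 (f : dual) : 0 <= dual_norm f.
Proof. by rewrite (le_trans _ (@dual_norm_le1 f 0 _)) ?normr0. Qed.

Lemma le_dual_norm (f : dual) x : `|f x| <= dual_norm f * `|x|.
Proof.
have [->|x0] := eqVneq x 0; first by rewrite linear0 !normr0 mulr0.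
have nx0 : 0 < `|x| by rewrite normr_gt0.
rewrite -ler_pdivrMr//.
have := @dual_norm_le1 f (`|x|^-1 *: x).
rewrite linearZ/= !normrZ ger0_norm ?invr_ge0// mulVf ?gt_eqF//.
by rewrite mulrC; apply.
Qed.

Lemma dual_norm_le (f : dual) (M : R) :
  0 <= M -> (forall x, `|f x| <= M * `|x|) -> dual_norm f <= M.
Proof.
move=> M0 fM; apply: ge_sup; first by case: (dual_norm_has_sup f).
by move=> _ /= [x x1 <-]; rewrite (le_trans (fM x))// ler_piMr.
Qed.

Let dual_normD (f g : dual) : dual_norm (f + g) <= dual_norm f + dual_norm g.
Proof.
apply: dual_norm_le => [|x]; first by rewrite addr_ge0 ?dual_norm_ge0.
by rewrite mulrDl (le_trans (ler_normD _ _))// lerD// le_dual_norm.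
Qed.

Let dual_normZ_le (a : R) (f : dual) : dual_norm (a *: f) <= `|a| * dual_norm f.
Proof.
apply: dual_norm_le => [|x]; first by rewrite mulr_ge0 ?dual_norm_ge0.
by rewrite [leLHS](normrZ a (f x)) -mulrA ler_wpM2l ?le_dual_norm.
Qed.

Let dual_normZ (a : R) (f : dual) : dual_norm (a *: f) = `|a| * dual_norm f.
Proof.
apply/eqP; rewrite eq_le dual_normZ_le/=.
have [->|a0] := eqVneq a 0; first by rewrite normr0 mul0r dual_norm_ge0.
rewrite -ler_pdivlMl ?normr_gt0// -normfV.
by rewrite -[leLHS]/(dual_norm f) -{1}(scalerK a0 f) dual_normZ_le.
Qed.

Let dual_norm0_eq0 (f : dual) : dual_norm f = 0 -> f = 0.
Proof.
move=> f0; apply: dualP => x; apply/eqP; rewrite -normr_le0.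
by rewrite (le_trans (le_dual_norm f x))// f0 mul0r.
Qed.

HB.instance Definition _ := Lmodule_isNormed.Build R dual
  dual_normD dual_normZ dual_norm0_eq0.

Lemma dual_normE (f : dual) : `|f| = dual_norm f.
Proof. by []. Qed.

End Dual.

Definition linearly_independent (R : realType) (V : lmodType R) (n : nat)
    (v : 'I_n -> V) : Prop :=
  forall a : 'I_n -> R, \sum_i a i *: v i = 0 -> forall i, a i = 0.

(* Meaningful also in infinite dimension. *)
Definition dim_ge (R : realType) (V : lmodType R) (n : nat) : Prop :=
  exists v : 'I_n -> V, linearly_independent v.

(* On a complete space this says that V is a Hilbert space for its own norm;
   {dot V for idfun} is the type of real inner products on V. *)
Definition norm_from_inner_product (R : realType) (V : normedModType R) : Prop :=
  exists dot : {dot V for idfun}, forall x : V, `|x| = Num.sqrt (dot x x).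

Definition birkhoff_james (R : realType) (V : normedModType R) (x y : V) : Prop :=
  forall a : R, `|x + a *: y| >= `|x|.

Definition operator_orthogonal (R : realType) (V : normedModType R)
    (T : V -> dual V) (x y : V) : Prop :=
  T x y = 0.

(* Main.v *)
(** Put B(x, y) = T x y up to sign.  If ⊥_T = ⊥_B, then B is definite and every
    B(x, -) is a multiple of a norming functional of x, that is,
    |x| B(x, y) <= |y| B(x, x).  Let u, v satisfy B(u, u) = B(v, v) = 1 and
    B(v, u) = - B(u, v) = - c.  For the norm phi(t) of cos t u + sin t v, this
    inequality reads phi(t) (cos h + c sin h) <= phi(t + h).  Iterating it n times
    with h = pi / n leads from u to - u, so (cos h + c sin h)^n <= 1; if c > 0 this
    fails for large n, and likewise with u and v exchanged if c < 0.  Hence c = 0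
    and B is symmetric.  With c = 0 and h = t / n, cos(t / n)^n -> 1 shows that the
    norm is constant on the unit sphere of B, so |x|^2 is a multiple of B(x, x). *)
Require Import Defs.
From HB Require Import structures.
From mathcomp Require Import all_boot all_order all_algebra.
From mathcomp Require Import all_classical all_reals all_analysis.
From mathcomp Require Import ring lra.
Import Order.TTheory GRing.Theory Num.Theory.
Import numFieldNormedType.Exports.
Local Open Scope ring_scope.

(** * Trigonometric estimates at small angles *)

Lemma norm_sin_le (R : realType) (t : R) : `|sin t| <= `|t|.
Proof.
wlog t0 : t / 0 <= t => [wl|].
  have [/wl//|/ltW] := leP 0 t; rewrite -oppr_ge0 => /wl.
  by rewrite sinN !normrN.
have [|c _] := @MVT_segment R sin cos 0 t t0.
  by apply: continuous_subspaceT => x; exact: continuous_sin.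
by rewrite sin0 !subr0 => ->; rewrite normrM ler_piMl// cos_max.
Qed.

Lemma cos_ge_quadratic (R : realType) (t : R) : 1 - t ^+ 2 / 2 <= cos t.
Proof.
have -> : cos t = 1 - 2 * sin (t / 2) ^+ 2.
  have {1}-> : t = (t / 2) *+ 2 by rewrite -mulr_natr divfK.
  by rewrite cos_mulr2n cos2sin2 -mulr_natr; ring.
have : sin (t / 2) ^+ 2 <= (t / 2) ^+ 2.
  by rewrite -[leLHS]real_normK ?num_real// -[leRHS]real_normK ?num_real//
     ler_sqr ?nnegrE// norm_sin_le.
by rewrite expr_div_n; lra.
Qed.

(** With [k] half the angle, the excess over 1 factors as [2 * sin k * (c * cos k - sin k)]. The
    bound [d] makes it positive: it forces [sin k <= k < c / 2] and [1 / 2 <= cos k]. *)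
Lemma cos_add_sin_gt1 (R : realType) (c : R) : 0 < c ->
  exists n : nat, 1 < cos (pi / n.+1%:R) + c * sin (pi / n.+1%:R).
Proof.
move=> c0; pose d : R := Num.min 1 (c / 2).
have d0 : 0 < d by rewrite lt_min ltr01 divr_gt0.
have pi0 := @pi_gt0 R.
pose n := Num.bound (pi / d); exists n.
have n0 : (0 : R) < n.+1%:R by rewrite ltr0n.
set h := pi / _; pose k := h / 2.
have h0 : 0 < h by rewrite divr_gt0.
have hd : h < d.
  rewrite ltr_pdivrMr// mulrC -ltr_pdivrMr//.
  rewrite (lt_le_trans (archi_boundP _)) ?ler_nat//.
  by rewrite divr_ge0 ?ltW.
have k0 : 0 < k by rewrite divr_gt0.
have [k1 kc] : k < 1 /\ k < c / 2.
  by move: hd; rewrite lt_min /k => /andP[]; lra.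
have sk0 : 0 < sin k.
  by apply: sin_gt0_pihalf; rewrite k0 (lt_le_trans k1)// pihalf_ge1.
have skk : sin k <= k.
  by have := norm_sin_le _ k; rewrite !gtr0_norm.
have ck : 1 / 2 <= cos k.
  apply: le_trans (cos_ge_quadratic _ k).
  have : k ^+ 2 <= 1 by rewrite expr_le1// ltW.
  by lra.
have -> : h = k *+ 2 by rewrite -mulr_natr divfK.
rewrite cos_mulr2n sin_mulr2n cos2sin2 -subr_gt0.
have -> : (1 - sin k ^+ 2) *+ 2 - 1 + c * ((cos k * sin k) *+ 2) - 1 =
  2 * sin k * (c * cos k - sin k) by rewrite !mulr2n; ring.
by rewrite mulr_gt0 ?mulr_gt0// subr_gt0; nra.
Qed.

Lemma bernoulli_ineq (R : realDomainType) (x : R) n :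
  0 <= x <= 1 -> 1 - n%:R * x <= (1 - x) ^+ n.
Proof.
move=> /andP[x0 x1]; elim: n => [|n IHn]; first by rewrite mul0r subr0.
rewrite exprSr; have y0 : 0 <= 1 - x by rewrite subr_ge0.
apply: le_trans (ler_wpM2r y0 IHn).
have : 0 <= n%:R * x * x by rewrite !mulr_ge0.
by rewrite -natr1; lra.
Qed.

(** Since [1 - cos h <= h ^+ 2 / 2], Bernoulli's inequality shows that [cos (t / n) ^+ n] tends to
    1. *)
Lemma le_of_mul_cos_pow (R : realType) (t p q : R) : 0 <= p ->
  (forall n : nat, 0 <= cos (t / n.+1%:R) ->
    p * cos (t / n.+1%:R) ^+ n.+1 <= q) -> p <= q.
Proof.
move=> p0 pq; rewrite leNgt; apply/negP => qp.
pose d := p - q; have d0 : 0 < d by rewrite subr_gt0.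
(* The first summand gives [h ^+ 2 <= 1], hence [0 <= cos h]; the second makes the loss
   [p * t ^+ 2 / n.+1%:R] smaller than the gap [d]. *)
pose n := Num.bound (t ^+ 2 + p * t ^+ 2 / d).
have n0 : (0 : R) < n.+1%:R by rewrite ltr0n.
have ptd : 0 <= p * t ^+ 2 / d.
  by rewrite divr_ge0 ?(ltW d0)// mulr_ge0 ?sqr_ge0.
have nP : t ^+ 2 + p * t ^+ 2 / d < n.+1%:R.
  rewrite (lt_le_trans (archi_boundP _)) ?ler_nat//.
  by rewrite addr_ge0// sqr_ge0.
set h := t / n.+1%:R in pq *; have := pq n; rewrite -/h.
have nhh : n.+1%:R * h ^+ 2 = t ^+ 2 / n.+1%:R.
  by rewrite /h; field; rewrite nat1r pnatr_eq0.
have hh1 : h ^+ 2 <= 1.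
  rewrite expr_div_n ler_pdivrMr ?exprn_gt0// mul1r.
  have : (1 : R) <= n.+1%:R by rewrite ler1n.
  by move: nP ptd; nra.
have ch := cos_ge_quadratic _ h.
have c0 : 0 <= cos h by lra.
move=> /(_ c0); apply/negP; rewrite -ltNge.
have /(bernoulli_ineq _ _ n.+1) : 0 <= 1 - cos h <= 1.
  by rewrite subr_ge0 cos_le1/=; lra.
rewrite subKr => bern.
apply: lt_le_trans (ler_wpM2l p0 bern).
have h1 : n.+1%:R * (1 - cos h) <= t ^+ 2 / n.+1%:R.
  rewrite -nhh ler_pM2l//; have := sqr_ge0 h; lra.
have h2 : p * (t ^+ 2 / n.+1%:R) < d.
  rewrite mulrA ltr_pdivrMr// [ltRHS]mulrC -ltr_pdivrMr//.
  by apply: le_lt_trans nP; rewrite lerDr sqr_ge0.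
rewrite mulrBr mulr1 ltrBrDr -ltrBrDl.
exact: le_lt_trans (ler_wpM2l p0 h1) h2.
Qed.

(** * Positive definite forms that support the norm: symmetry and proportionality *)

Section SupportingForm.
Context (R : realType) (X : normedModType R).
Context (B : {bilinear X -> X -> R | *%R & *%R}).
Context (Bpos : forall x, x != 0 -> 0 < B x x).
Context (Bsupp : forall x y, `|x| * B x y <= `|y| * B x x).

Let BE := (linearDl B, linearDr B, linearZl_LR B, linearZr_LR B,
           linearNl B, linearNr B).

Let arc (u v : X) (t : R) : X := cos t *: u + sin t *: v.

(** Skewness cancels the cross terms, so the arc stays on the unit sphere of [B], and [B] of two of
    its points depends only on their angle [h]. *)
Lemma norm_arc_step (u v : X) t h : B u u = 1 -> B v v = 1 -> B v u = - B u v ->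
  `|arc u v t| * (cos h + B u v * sin h) <= `|arc u v (t + h)|.
Proof.
move=> uu vv vu; have := Bsupp (arc u v t) (arc u v (t + h)).
have -> : B (arc u v t) (arc u v t) = 1.
  by rewrite !BE uu vv vu /= -[RHS](cos2Dsin2 t); ring.
have -> : B (arc u v t) (arc u v (t + h)) = cos h + B u v * sin h.
  rewrite !BE uu vv vu cosD sinD /=.
  transitivity ((cos t ^+ 2 + sin t ^+ 2) * (cos h + B u v * sin h)).
    by ring.
  by rewrite cos2Dsin2 mul1r.
by rewrite mulr1.
Qed.

Lemma norm_arc_iter (u v : X) h n : B u u = 1 -> B v v = 1 -> B v u = - B u v ->
  0 <= cos h + B u v * sin h ->
  `|u| * (cos h + B u v * sin h) ^+ n <= `|arc u v (h * n%:R)|.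
Proof.
move=> uu vv vu h0; elim: n => [|n IHn].
  by rewrite expr0 mulr1 mulr0 /arc cos0 sin0 scale1r scale0r addr0.
rewrite exprSr mulrA (le_trans (ler_wpM2r h0 IHn))//.
by rewrite -natr1 (mulrDr h) mulr1 norm_arc_step.
Qed.

Lemma form_normalize (x : X) : x != 0 ->
  B ((Num.sqrt (B x x))^-1 *: x) ((Num.sqrt (B x x))^-1 *: x) = 1.
Proof.
move=> /Bpos Bx; rewrite !BE /= mulrA -invfM -expr2 sqr_sqrtr ?ltW//.
by rewrite mulVf ?gt_eqF.
Qed.

Lemma form_skew_eq0 (u v : X) : B v u = - B u v -> B u v = 0.
Proof.
have [->|u0] := eqVneq u 0; first by rewrite linear0l.
have [->|v0] := eqVneq v 0; first by rewrite linear0r.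
have [uu vv] := (form_normalize _ u0, form_normalize _ v0) => vu.
set a := _^-1 in uu; set b := _^-1 in vv.
have a0 : a != 0 by rewrite invr_eq0 gt_eqF ?sqrtr_gt0 ?Bpos.
have b0 : b != 0 by rewrite invr_eq0 gt_eqF ?sqrtr_gt0 ?Bpos.
suff : B (a *: u) (b *: v) = 0.
  by rewrite !BE /= => /eqP; rewrite !mulf_eq0 (negPf a0) (negPf b0) => /eqP.
have {vu} : B (b *: v) (a *: u) = - B (a *: u) (b *: v).
  by rewrite !BE /= vu; ring.
move: (a *: u) (b *: v) uu vv => p q uu vv.
have contra (x y : X) : B x x = 1 -> B y y = 1 -> B y x = - B x y ->
    ~ 0 < B x y.
  move=> xx yy yx /cos_add_sin_gt1[n].
  set h := pi / _ => h1.
  have := norm_arc_iter _ _ h n.+1 xx yy yx (le_trans ler01 (ltW h1)).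
  rewrite /h divfK ?pnatr_eq0// /arc cospi sinpi scale0r addr0 scaleN1r normrN.
  rewrite ger_pMr; last first.
    rewrite normr_gt0; apply/eqP => x0; move: xx => /eqP.
    by rewrite x0 linear0l eq_sym oner_eq0.
  by apply/negP; rewrite -ltNge exprn_egt1.
move=> vu; apply/eqP; rewrite eq_le !leNgt; apply/andP; split; apply/negP.
  exact: contra.
rewrite -oppr_gt0 -vu; apply: contra => //.
by rewrite vu opprK.
Qed.

Lemma form_sym (x y : X) : B x y = B y x.
Proof.
have [->|x0] := eqVneq x 0; first by rewrite linear0l linear0r.
(* This [a] solves [B (y - a *: x) x = - B x (y - a *: x)]. Both sides then vanish by the skew case,
   so [B x y] and [B y x] both equal [a * B x x]. *)
have xx := Bpos _ x0; pose a := (B x y + B y x) / (2 * B x x).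
have wx : B (y - a *: x) x = - B x (y - a *: x).
  by rewrite !BE /= /a; field; rewrite gt_eqF.
have xw := form_skew_eq0 _ _ wx; move: wx; rewrite xw oppr0.
move: xw; rewrite !BE /= => /subr0_eq -> /subr0_eq ->.
by [].
Qed.

(** Gram-Schmidt places [y] on the arc from [x] through a unit vector [v] with [B x v = 0], at angle
    [acos a]; each of the equal steps along it costs only a cosine factor. If [w = 0], no [v]
    exists, but then [y] is [x] up to sign. *)
Lemma unit_norm_le (x y : X) : B x x = 1 -> B y y = 1 -> `|x| <= `|y|.
Proof.
move=> xx yy; pose a := B x y; pose w := y - a *: x.
have ww : B w w = 1 - a ^+ 2.
  by rewrite !BE /= xx yy (form_sym y) -/a; ring.
have yE : y = a *: x + w by rewrite /w addrC subrK.
have [w0|w0] := eqVneq w 0.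
  move: ww; rewrite w0 linear0l => /esym/subr0_eq/esym/eqP.
  rewrite -real_normK ?num_real// sqrp_eq1// => /eqP a1.
  by rewrite yE w0 addr0 normrZ a1 mul1r.
have a1 : a ^+ 2 < 1 by rewrite -subr_gt0 -ww Bpos.
have /andP[aN1 a1'] : -1 <= a <= 1.
  by rewrite -ler_norml -(@expr_le1 _ 2)// real_normK ?num_real// ltW.
pose b := Num.sqrt (1 - a ^+ 2); pose v := b^-1 *: w.
have vv : B v v = 1 by rewrite /v /b -ww form_normalize.
have xw : B x w = 0 by rewrite !BE /= xx -/a; ring.
have xv : B x v = 0 by rewrite linearZr_LR /= xw mulr0.
have b0 : b != 0 by rewrite gt_eqF// sqrtr_gt0 subr_gt0.
have yarc : y = arc x v (acos a).
  rewrite /arc acosK ?in_itv/= ?aN1// sin_acos ?aN1// -/b scalerA divff//.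
  by rewrite scale1r.
apply: (@le_of_mul_cos_pow _ (acos a)) => // n.
set h := _ / _ => h0; have := norm_arc_iter x v h n.+1.
rewrite xv mul0r addr0 /h divfK ?pnatr_eq0// -yarc; apply => //.
by rewrite form_sym xv oppr0.
Qed.

Lemma sqr_norm_form (x y : X) : `|x| ^+ 2 * B y y = `|y| ^+ 2 * B x x.
Proof.
have [->|x0] := eqVneq x 0; first by rewrite normr0 linear0l; ring.
have [->|y0] := eqVneq y 0; first by rewrite normr0 linear0l; ring.
have [xx yy] := (form_normalize _ x0, form_normalize _ y0).
have : `|(Num.sqrt (B x x))^-1 *: x| = `|(Num.sqrt (B y y))^-1 *: y|.
  by apply/eqP; rewrite eq_le !unit_norm_le.
have sx : 0 < Num.sqrt (B x x) by rewrite sqrtr_gt0 Bpos.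
have sy : 0 < Num.sqrt (B y y) by rewrite sqrtr_gt0 Bpos.
rewrite !normrZ !gtr0_norm ?invr_gt0// => /(congr1 (fun r => r ^+ 2)).
rewrite !exprMn !exprVn !sqr_sqrtr ?ltW ?Bpos// => e.
apply: (@mulfI _ ((B x x)^-1 * (B y y)^-1)).
  by rewrite mulf_neq0// invr_eq0 gt_eqF ?Bpos.
transitivity ((B x x)^-1 * `|x| ^+ 2).
  by field; rewrite !gt_eqF ?Bpos.
by rewrite e; field; rewrite !gt_eqF ?Bpos.
Qed.

End SupportingForm.

(** * Building the inner product, and preliminaries on orthogonality and the dual *)

Lemma norm_from_proportional_form (R : realType) (X : normedModType R)
    (B : {bilinear X -> X -> R | *%R & *%R}) (k : R) : 0 < k ->
  (forall x y, B x y = B y x) -> (forall x, x != 0 -> 0 < B x x) ->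
  (forall x, `|x| ^+ 2 = k * B x x) -> norm_from_inner_product X.
Proof.
move=> k0 Bsym Bpos normE; pose f x y := k * B x y.
pose b := isBilinear.Build R X X R *%R (idfun \; *%R) f.
have fl y : zmod_morphism (f ^~ y) by move=> x z; rewrite /f linearBl mulrBr.
have fr x : zmod_morphism (f x) by move=> y z; rewrite /f linearBr mulrBr.
have fZl y : scalable_for *%R (f ^~ y).
  by move=> a x; rewrite /f linearZl_LR /= mulrCA.
have fZr x : scalable_for (idfun \; *%R) (f x).
  by move=> a y; rewrite /f linearZr_LR /= mulrCA.
have herm x y : f x y = (-1) ^+ false * idfun (f y x).
  by rewrite expr0 mul1r /f Bsym.
have fpos x : x != 0 -> 0 < f x x by move=> /Bpos Bx; rewrite mulr_gt0.
(* The sign exponent [false] and the conjugation [idfun] turn Hermitian symmetry into plain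
   symmetry. *)
pose d : {dot X for idfun} := HB.pack f (b fl fr fZl fZr)
  (isHermitianSesquilinear.Build R X false idfun f herm)
  (isDotProduct.Build R X f fpos).
exists d => x; rewrite -[RHS]/(Num.sqrt (f x x)) /f -normE.
by rewrite sqrtr_sqr normr_id.
Qed.

Lemma birkhoff_james_refl (R : realType) (X : normedModType R) (x : X) :
  birkhoff_james x x -> x = 0.
Proof.
by move=> /(_ (-1)); rewrite scaleN1r subrr normr0 normr_le0 => /eqP.
Qed.

Lemma dim_ge_neq0 (R : realType) (V : lmodType R) (n : nat) :
  dim_ge V n.+1 -> exists e : V, e != 0.
Proof.
move=> [v vfree]; exists (v ord0); apply/eqP => v0.
have := vfree (fun i => (i == ord0)%:R) _ ord0.
rewrite big1 => [/(_ erefl)/eqP|i _]; first by rewrite eqxx oner_eq0.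
by have [->|_] := eqVneq i ord0; rewrite ?v0 ?scaler0 ?scale0r.
Qed.

Lemma dual_addE (R : realType) (X : normedModType R) (f g : dual X) x :
  (f + g) x = f x + g x.
Proof. by []. Qed.

Lemma dual_scaleE (R : realType) (X : normedModType R) (a : R) (f : dual X) x :
  (a *: f) x = a * f x.
Proof. by []. Qed.

(** * The form of an operator whose orthogonality is that of Birkhoff and James *)

Section OperatorForm.
Context (R : realType) (X : normedModType R) (T : {linear X -> dual X}).

(** The factor [s] is there to be a sign that makes the form positive. *)
Definition operator_form (s : R) (x y : X) : R := s * T x y.

Lemma operator_form_bilinear s :
  bilinear_for ( *%R : GRing.Scale.law R R) ( *%R : GRing.Scale.law R R)
    (operator_form s).
Proof.
split=> [y a x z|x a y z]; rewrite /operator_form; last first.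
  by rewrite (linearP (T x)) mulrDr; congr (_ + _); exact: mulrCA.
have -> : T (a *: x + z) = a *: T x + T z by exact: linearP.
by rewrite dual_addE dual_scaleE mulrDr; congr (_ + _); exact: mulrCA.
Qed.

HB.instance Definition _ s := bilinear_isBilinear.Build R X X R
  ( *%R : GRing.Scale.law R R) ( *%R : GRing.Scale.law R R)
  (operator_form s) (operator_form_bilinear s).

Context (T_BJ : forall x y, operator_orthogonal T x y <-> birkhoff_james x y).

Lemma operator_form_neq0 x : x != 0 -> T x x != 0.
Proof. by apply: contraNneq => /T_BJ/birkhoff_james_refl ->. Qed.

(** The vector [y - r *: x] lies in the kernel of [T x], hence is Birkhoff-James orthogonal to [x].
    Adding its multiple by [r^-1] to [x] leaves [r^-1 *: y], whose norm is therefore at least that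
    of [x]. *)
Lemma operator_form_support x y : `|x| * `|T x y| <= `|y| * `|T x x|.
Proof.
have [->|x0] := eqVneq x 0; first by rewrite normr0 mul0r mulr_ge0.
have Tx := operator_form_neq0 _ x0; pose r := T x y / T x x.
have [Txy|Txy] := eqVneq (T x y) 0; first by rewrite Txy normr0 mulr0 mulr_ge0.
have r0 : r != 0 by rewrite mulf_neq0 ?invr_eq0.
have /T_BJ/(_ r^-1) : operator_orthogonal T x (y - r *: x).
  by rewrite /operator_orthogonal linearB linearZ /= /r [_ *: _]divfK ?subrr.
rewrite scalerBr scalerA mulVf// scale1r addrC subrK normrZ normfV.
rewrite ler_pdivlMl ?normr_gt0// /r normf_div mulrAC ler_pdivrMr ?normr_gt0//.
by rewrite mulrC.
Qed.

(** The quadratic polynomial [T (x + t *: y) (x + t *: y)] in [t] has extreme coefficients of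
    opposite signs, hence a real root. There [x + t *: y] is orthogonal to itself, so it is zero,
    and [T x x = t ^+ 2 * T y y] is not positive. *)
Lemma operator_form_same_sign x y : 0 < T x x -> T y y < 0 -> False.
Proof.
move=> Tx Ty; pose a := T y y; pose b := T x y + T y x; pose c := T x x.
pose D := b ^+ 2 - 4 * a * c.
have D0 : 0 <= D by rewrite /D -/a -/c in Tx Ty *; have := sqr_ge0 b; nra.
have a0 : a != 0 by rewrite lt_eqF.
pose t := (Num.sqrt D - b) / (2 * a).
have root : a * t ^+ 2 + b * t + c = 0.
  have -> : a * t ^+ 2 + b * t + c = (Num.sqrt D ^+ 2 - D) / (4 * a).
    by rewrite /t /D; field.
  by rewrite sqr_sqrtr// subrr mul0r.
clearbody t.
have Txt : T (x + t *: y) (x + t *: y) = 0.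
  have -> : T (x + t *: y) = T x + t *: T y by rewrite raddfD /= linearZ.
  rewrite dual_addE dual_scaleE !linearD !linearZ /=.
  by rewrite -root /a /b /c /GRing.scale/=; ring.
have /eqP xty : x + t *: y = 0 by exact/birkhoff_james_refl/T_BJ.
have xE : x = (- t) *: y by rewrite scaleNr; apply/eqP; rewrite -addr_eq0.
have TxE : T x = (- t) *: T y by rewrite xE linearZ.
have : T x x = t ^+ 2 * T y y.
  by rewrite TxE dual_scaleE xE linearZ /= /GRing.scale/=; ring.
apply/eqP; rewrite gt_eqF// (le_lt_trans _ Tx)//.
by rewrite mulr_ge0_le0 ?sqr_ge0 ?ltW.
Qed.

Lemma operator_form_definite (e : X) : e != 0 ->
  exists s : R, (forall x, x != 0 -> 0 < operator_form s x x) /\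
    (forall x y, `|x| * operator_form s x y <= `|y| * operator_form s x x).
Proof.
move=> e0; pose s := Num.sg (T e e); exists s.
have Bpos x : x != 0 -> 0 < operator_form s x x.
  move=> /operator_form_neq0; rewrite /operator_form /s.
  have := operator_form_neq0 _ e0; rewrite !neq_lt => /orP[Te|Te] /orP[Tx|Tx].
  - by rewrite ltr0_sg// mulN1r oppr_gt0.
  - by have := operator_form_same_sign _ _ Tx Te.
  - by have := operator_form_same_sign _ _ Te Tx.
  - by rewrite gtr0_sg// mul1r.
split=> // x y; have [->|x0] := eqVneq x 0.
  by rewrite normr0 mul0r linear0l mulr0.
have s1 z : `|operator_form s x z| = `|T x z|.
  by rewrite normrM normr_sg operator_form_neq0// mul1r.
rewrite -[X in _ <= _ * X]gtr0_norm ?Bpos// s1.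
by rewrite (le_trans _ (operator_form_support x y))// ler_wpM2l// -s1 ler_norm.
Qed.

End OperatorForm.

(** * The Riesz map of an inner product *)

Section DotOperator.
Context (R : realType) (X : normedModType R) (dot : {dot X for idfun}).
Context (normE : forall x : X, `|x| = Num.sqrt (dot x x)).

Lemma dot_sym x y : dot x y = dot y x.
Proof. by rewrite hermC expr0 mul1r. Qed.

Lemma sqr_norm_dot x : `|x| ^+ 2 = dot x x.
Proof.
rewrite normE sqr_sqrtr//; have [->|/neq0_dnorm_gt0/ltW//] := eqVneq x 0.
by rewrite linear0l.
Qed.

Lemma sqr_normD_dot x y (a : R) :
  `|x + a *: y| ^+ 2 = `|x| ^+ 2 + 2 * a * dot x y + a ^+ 2 * `|y| ^+ 2.
Proof.
rewrite !sqr_norm_dot !(linearDl, linearDr) /= !(linearZl_LR, linearZr_LR) /=.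
by rewrite (dot_sym y) /GRing.scale/=; ring.
Qed.

(** Cauchy-Schwarz, from the sign of the squared norm of the component of [x] orthogonal to [y]. *)
Lemma norm_dot_le x y : `|dot x y| <= `|x| * `|y|.
Proof.
have [->|y0] := eqVneq y 0; first by rewrite linear0r !normr0 mulr0.
have yy : 0 < `|y| ^+ 2 by rewrite exprn_gt0 ?normr_gt0.
have := sqr_ge0 `|x + (- (dot x y / `|y| ^+ 2)) *: y|.
rewrite sqr_normD_dot.
have -> : `|x| ^+ 2 + 2 * - (dot x y / `|y| ^+ 2) * dot x y +
  (- (dot x y / `|y| ^+ 2)) ^+ 2 * `|y| ^+ 2 =
  `|x| ^+ 2 - dot x y ^+ 2 / `|y| ^+ 2.
  by field; rewrite normr_eq0.
rewrite subr_ge0 ler_pdivrMr// -exprMn -[dot x y ^+ 2]real_normK ?num_real//.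
by rewrite ler_sqr ?nnegrE// mulr_ge0.
Qed.

Lemma birkhoff_james_dot x y : birkhoff_james x y <-> dot x y = 0.
Proof.
split=> [xy|xy a]; last first.
  rewrite -ler_sqr ?nnegrE// sqr_normD_dot xy mulr0 addr0 lerDl.
  by rewrite mulr_ge0 ?sqr_ge0.
have [->|y0] := eqVneq y 0; first by rewrite linear0r.
have yy : 0 < `|y| ^+ 2 by rewrite exprn_gt0 ?normr_gt0.
(* This coefficient minimises the norm of [x + a *: y]; the square drops by
   [dot x y ^+ 2 / |y| ^+ 2], which orthogonality allows only if it is zero. *)
have := xy (- (dot x y / `|y| ^+ 2)).
rewrite -ler_sqr ?nnegrE// sqr_normD_dot -addrA lerDl.
have -> : 2 * - (dot x y / `|y| ^+ 2) * dot x y +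
  (- (dot x y / `|y| ^+ 2)) ^+ 2 * `|y| ^+ 2 = - (dot x y ^+ 2 / `|y| ^+ 2).
  by field; rewrite normr_eq0.
rewrite oppr_ge0 pmulr_lle0 ?invr_gt0// => d0.
by apply/eqP; rewrite -sqrf_eq0 eq_le d0 sqr_ge0.
Qed.

Lemma dot_dual_pred x : (dot x : X -> R^o) \in @dual_pred R X.
Proof.
apply/asboolP; split=> [a y z|]; first by rewrite linearPr.
by exists `|x| => y; exact: norm_dot_le.
Qed.

Definition riesz_map x : dual X := Dual (dot_dual_pred x).

Lemma riesz_map_linear : linear riesz_map.
Proof. by move=> a x y; apply: dualP => z; rewrite /= linearPl. Qed.

HB.instance Definition _ :=
  GRing.isLinear.Build R X (dual X) *:%R riesz_map riesz_map_linear.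

Lemma riesz_map_bounded : bounded_operator riesz_map.
Proof.
exists 1 => x; rewrite mul1r dual_normE dual_norm_le// => y.
exact: norm_dot_le.
Qed.

End DotOperator.

Theorem theorem2p16 (R : realType) (X : completeNormedModType R)
    (dimX : dim_ge X 3) :
  norm_from_inner_product X <->
  exists T : {linear X -> dual X},
    bounded_operator T /\
    (forall x y : X, operator_orthogonal T x y <-> birkhoff_james x y).
Proof.
split=> [[dot normE]|[T [_ T_BJ]]].
  exists (riesz_map R X dot normE : {linear X -> dual X}); split.
    exact: riesz_map_bounded.
  by move=> x y; rewrite (birkhoff_james_dot R X dot normE).
(* The nonzero vector [e] fixes both the sign of the form and the constant ratio of the squared norm
   to it. *)
have [e e0] := dim_ge_neq0 R X 2 dimX.
have [s [Bpos Bsupp]] := operator_form_definite R X T T_BJ e e0.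
have Bsym := form_sym R X _ Bpos Bsupp.
apply: (norm_from_proportional_form R X _
  (`|e| ^+ 2 / operator_form R X T s e e) _ Bsym Bpos) => [|x].
  by rewrite divr_gt0 ?Bpos// exprn_gt0 ?normr_gt0.
have := sqr_norm_form R X _ Bpos Bsupp e x => E.
by rewrite mulrAC E mulfK// gt_eqF ?Bpos.
Qed.
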